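(* Let $R$ be a commutative ring with $1$ containing $\mathbb{Q}$, and let $F=\exp(D)$ be a unipotent polynomial automorphism of $R^{[n]}=R[x_1,\ldots,x_n]$, where $D$ is a locally nilpotent $R$-derivation of $R^{[n]}$. Let $N=F-I$, viewed as the $R$-linear map $R^{[n]}\to R^{[n]}$, $g\mapsto F(g)-g$. Then (1) $\operatorname{inv}(F)=\ker(D)$ $(=\ker(N))$; (2) $\operatorname{Im}(N)=\operatorname{Im}(D)$.
   Context: A polynomial automorphism $F=(F_1,\ldots,F_n)$ of $R^{[n]}$ acts on $g\in R^{[n]}$ by $F(g)=g(F_1,\ldots,F_n)$. $\operatorname{inv}(F)=\{g\in R^{[n]} : F(g)=g\}$. $F$ is called unipotent if there is $d\in\mathbb{N}$ such that $\sum_{i=0}^d\binom{d}{i}(-1)^{d-i}F^i=0$, where $F^i$ is the $i$-th iterate and sums of maps are taken componentwise (i.e. $F$ is a zero of the polynomial $(T-1)^d$). An $R$-linear map $D:R^{[n]}\to R^{[n]}$ is a derivation if $D(fg)=fD(g)+D(f)g$ for all $f,g$; it is locally nilpotent if for each $f$ there is $d\in\mathbb{N}$ with $D^d(f)=0$. For such $D$, $\exp(D)=\sum_{i\ge 0}\frac{1}{i!}D^i$, identified with the polynomial automorphism $(\exp(D)(x_1),\ldots,\exp(D)(x_n))$. *)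

(* Defs.v *)
From HB Require Import structures.
From mathcomp Require Export all_boot all_order all_algebra.
From mathcomp.multinomials Require Export mpoly.

Set Implicit Arguments.
Unset Strict Implicit.
Unset Printing Implicit Defensive.

Import GRing.Theory.
Local Open Scope ring_scope.

(* A commutative ring with 1 containing the rationals is a [comAlgType rat]
   (rings of this type are nonzero).  An endomorphism of R^[n] is the tuple of
   its components (F_1, ..., F_n). *)

Section PolynomialAutomorphisms.
Variables (R : comNzRingType) (n : nat).
Implicit Types (F G : n.-tuple {mpoly R[n]}) (f g : {mpoly R[n]}).

Definition pid : n.-tuple {mpoly R[n]} := [tuple 'X_j | j < n].

Definition pcomp F G : n.-tuple {mpoly R[n]} :=
  [tuple tnth F j \mPo G | j < n].

Definition piter (i : nat) F : n.-tuple {mpoly R[n]} := iter i (pcomp F) pid.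

Definition poly_automorphism F : Prop :=
  exists G, pcomp F G = pid /\ pcomp G F = pid.

Definition unipotent F : Prop :=
  exists d : nat, forall j : 'I_n,
    \sum_(i < d.+1)
       ('C(d, i)%:R * (-1) ^+ (d - i) : R) *: tnth (piter i F) j = 0.

(* The action g |-> F(g) = g(F_1, ..., F_n) on R^[n]. *)
Definition pact F : {linear {mpoly R[n]} -> {mpoly R[n]}} := comp_mpoly F.

Definition inv F : {mpoly R[n]} -> Prop := fun g => pact F g = g.

(* The linear map N = F - I. *)
Definition pactN F : {linear {mpoly R[n]} -> {mpoly R[n]}} := pact F \- idfun.

Definition derivation (D : {linear {mpoly R[n]} -> {mpoly R[n]}}) : Prop :=
  forall f g, D (f * g) = f * D g + D f * g.

Definition locally_nilpotent
    (D : {linear {mpoly R[n]} -> {mpoly R[n]}}) : Prop :=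
  forall f, exists d : nat, iter d D f == 0.

Definition kernel (L : {linear {mpoly R[n]} -> {mpoly R[n]}}) :
  {mpoly R[n]} -> Prop := fun g => L g = 0.

Definition image_of (L : {linear {mpoly R[n]} -> {mpoly R[n]}}) :
  {mpoly R[n]} -> Prop := fun h => exists g, L g = h.

End PolynomialAutomorphisms.

Section Exponential.
Variables (R : comAlgType rat) (n : nat).
Variable D : {linear {mpoly R[n]} -> {mpoly R[n]}}.
Hypothesis lnD : locally_nilpotent D.

Definition exp_trunc (d : nat) (f : {mpoly R[n]}) : {mpoly R[n]} :=
  \sum_(i < d) ((i`!%:R^-1 : rat)%:A : R) *: iter i D f.

(* exp(D)(f) is the sum of D^i(f) / i! over all i; it is cut at the least d
   with D^d(f) = 0, beyond which all terms vanish (lemma [lnexpE]). *)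
Definition lnexp (f : {mpoly R[n]}) : {mpoly R[n]} :=
  exp_trunc (ex_minn (lnD f)) f.

Definition pexp : n.-tuple {mpoly R[n]} := [tuple lnexp 'X_j | j < n].

Lemma lnexpE d f : iter d D f = 0 -> lnexp f = exp_trunc d f.
Proof.
move=> Dd0; rewrite /lnexp; case: ex_minnP => m /eqP Dm0 min_m.
have le_md : (m <= d)%N by apply: min_m; apply/eqP.
rewrite /exp_trunc -(subnKC le_md) big_split_ord /=.
rewrite [X in _ + X]big1 ?addr0 // => i _.
rewrite addnC iterD Dm0.
suff -> : iter i D 0 = 0 by rewrite scaler0.
by elim: (nat_of_ord i) => //= k ->; rewrite linear0.
Qed.

End Exponential.

(* Main.v *)
(** On [R^[n]] the automorphism [F] acts as the operator [exp(D)]: by the Leibniz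
    rule both are [R]-algebra morphisms, and they agree on the variables.  Hence
    [N = D \o U] with [U = sum_i D^i / (i+1)!], where [U - 1] strictly lowers the
    order of nilpotency under [D].  Both claims follow by induction on that order. *)
Require Import Defs.

Set Implicit Arguments.
Unset Strict Implicit.
Unset Printing Implicit Defensive.

Import GRing.Theory Num.Theory.
Local Open Scope ring_scope.

Section LocallyNilpotentDerivation.
Variables (R : comAlgType rat) (n : nat).
Variable D : {linear {mpoly R[n]} -> {mpoly R[n]}}.
Hypothesis derD : derivation D.
Hypothesis lnD : locally_nilpotent D.
Implicit Types f g h : {mpoly R[n]}.

Let c (i : nat) : R := (i`!%:R^-1 : rat)%:A.

Lemma iter_linear0 k : iter k D 0 = 0.
Proof. by elim: k => //= k ->; rewrite linear0. Qed.

Lemma iter_linearD k f g : iter k D (f + g) = iter k D f + iter k D g.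
Proof. by elim: k => //= k ->; rewrite linearD. Qed.

Lemma iter_linearZ k (a : R) f : iter k D (a *: f) = a *: iter k D f.
Proof. by elim: k => //= k ->; rewrite linearZ. Qed.

Lemma iter_linear_sum k m (G : 'I_m -> {mpoly R[n]}) :
  iter k D (\sum_(i < m) G i) = \sum_(i < m) iter k D (G i).
Proof.
elim: k => //= k ->; exact: linear_sum.
Qed.

Lemma iter_eq0_leq k m f : (k <= m)%N -> iter k D f = 0 -> iter m D f = 0.
Proof. by move=> /subnK <- Df0; rewrite iterD Df0 iter_linear0. Qed.

Lemma derivation1 : D 1 = 0.
Proof.
have := derD 1 1; rewrite !mul1r mulr1 => /eqP.
by rewrite -subr_eq subrr eq_sym => /eqP.
Qed.

Lemma leibniz m f g :
  iter m D (f * g) =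
  \sum_(i < m.+1) (iter i D f * iter (m - i) D g) *+ 'C(m, i).
Proof.
elim: m => [|m IHm]; first by rewrite big_ord1 /= bin0 mulr1n.
rewrite iterS IHm linear_sum /=.
under eq_bigr => i _ do rewrite linearMn derD mulrnDl -!iterS -subSn ?leq_ord //.
rewrite big_split /= [RHS]big_ord_recl.
rewrite [X in X + _]big_ord_recl -addrA; congr (_ + _).
  by rewrite !bin0 !subn0.
under [RHS]eq_bigr => i _ do rewrite lift0 binS mulrnDr subSS.
rewrite big_split /=; congr (_ + _).
(* After Pascal's rule the two sums differ only by a last term with coefficient ['C(m, m.+1)], which
   is zero. *)
by rewrite [RHS]big_ord_recr /= bin_small // mulr0n addr0.
Qed.

Lemma iter_mul_eq0 d e f g :
  iter d D f = 0 -> iter e D g = 0 -> iter (d + e) D (f * g) = 0.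
Proof.
move=> Df0 Dg0; rewrite leibniz big1 // => i _.
have [le_di|lt_id] := leqP d i.
  by rewrite (iter_eq0_leq le_di Df0) mul0r mul0rn.
rewrite (@iter_eq0_leq e _ g) ?mulr0 ?mul0rn //.
by rewrite -addnBAC ?leq_addl // ltnW.
Qed.

Lemma expcoefM m i : (i <= m)%N -> c i * c (m - i) = c m *+ 'C(m, i).
Proof.
move=> le_im; rewrite /c scalerMnl -scalerAl mul1r scalerA; congr (_ *: _).
rewrite -[RHS]mulr_natr -(bin_fact le_im) !natrM !invfM.
by rewrite [RHS]mulrC mulVKf // pnatr_eq0 -lt0n bin_gt0.
Qed.

(** In the Cauchy product of the two series, the factorials turn the Leibniz sum for [D^m (f * g)]
    into the coefficient of degree [m]; the bound [d + e] leaves no product term out. *)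
Lemma exp_truncM d e f g : iter d D f = 0 -> iter e D g = 0 ->
  exp_trunc D (d + e) (f * g) = exp_trunc D d f * exp_trunc D e g.
Proof.
move=> Df0 Dg0.
(* [P d f] is [exp(T D)(f)] in an auxiliary variable [T] that sorts the terms by degree; setting
   [T = 1] recovers the exponential. *)
pose P d f : {poly {mpoly R[n]}} := \poly_(i < d) (c i *: iter i D f).
have P1 d' f' : (P d' f').[1] = exp_trunc D d' f'.
  by rewrite horner_poly; apply: eq_bigr => i _; rewrite expr1n mulr1.
have coefP d' f' i : iter d' D f' = 0 -> (P d' f')`_i = c i *: iter i D f'.
  move=> Df'0; rewrite coef_poly; case: ltnP => // le_di.
  by rewrite (iter_eq0_leq le_di Df'0) scaler0.
have szPQ : (size (P d f * P e g)%R <= d + e)%N.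
  apply: leq_trans (size_polyMleq _ _) _.
  by apply: leq_trans (leq_pred _) _; rewrite leq_add ?size_poly.
rewrite -(P1 d) -(P1 e) -hornerM (horner_coef_wide _ szPQ); apply: eq_bigr => m _.
rewrite expr1n mulr1 coefM leibniz scaler_sumr; apply: eq_bigr => i _.
rewrite !coefP // -scalerAl -scalerAr scalerA expcoefM ?leq_ord //.
by rewrite -scalerMnr scalerMnl.
Qed.

Lemma lnexpM f g : lnexp lnD (f * g) = lnexp lnD f * lnexp lnD g.
Proof.
have [[d /eqP Df0] [e /eqP Dg0]] := (lnD f, lnD g).
rewrite (lnexpE lnD (iter_mul_eq0 Df0 Dg0)) exp_truncM //.
by rewrite (lnexpE lnD Df0) (lnexpE lnD Dg0).
Qed.

Lemma lnexpD f g : lnexp lnD (f + g) = lnexp lnD f + lnexp lnD g.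
Proof.
have [[d /eqP Df0] [e /eqP Dg0]] := (lnD f, lnD g).
have {}Df0 := iter_eq0_leq (leq_maxl d e) Df0.
have {}Dg0 := iter_eq0_leq (leq_maxr d e) Dg0.
have Dfg0 : iter (maxn d e) D (f + g) = 0 by rewrite iter_linearD Df0 Dg0 addr0.
rewrite (lnexpE lnD Df0) (lnexpE lnD Dg0) (lnexpE lnD Dfg0) /exp_trunc -big_split /=.
by apply: eq_bigr => i _; rewrite iter_linearD scalerDr.
Qed.

Lemma lnexpZ (a : R) f : lnexp lnD (a *: f) = a *: lnexp lnD f.
Proof.
have [d /eqP Df0] := lnD f.
have Daf0 : iter d D (a *: f) = 0 by rewrite iter_linearZ Df0 scaler0.
rewrite (lnexpE lnD Df0) (lnexpE lnD Daf0) /exp_trunc scaler_sumr.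
by apply: eq_bigr => i _; rewrite iter_linearZ !scalerA mulrC.
Qed.

Lemma lnexp_ker f : D f = 0 -> lnexp lnD f = f.
Proof.
move=> Df0; rewrite (@lnexpE _ _ _ lnD 1) // /exp_trunc big_ord1 /=.
by rewrite fact0 invr1 !scale1r.
Qed.

Lemma pact_pexp g : pact (pexp lnD) g = lnexp lnD g.
Proof.
rewrite /pact; elim/mpolyind: g => [|a m p _ _ IHp].
  by rewrite linear0 lnexp_ker // linear0.
rewrite linearD linearZ /= {}IHp lnexpD lnexpZ; congr (_ *: _ + _).
(* Multiplicativity reduces a monomial to powers of single variables. *)
rewrite comp_mpolyX [in RHS]mpolyXE_id.
elim/big_rec2: _ => [|i q p' _ ->]; first by rewrite lnexp_ker ?derivation1.
rewrite lnexpM; congr (_ * _); rewrite tnth_mktuple.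
elim: (m i) => [|k IHk]; first by rewrite !expr0 lnexp_ker ?derivation1.
by rewrite !exprS lnexpM IHk.
Qed.

(** This is [(U - 1) f], cut after [D^d] and reindexed to start at [D / 2!]. *)
Definition exp_tail d f : {mpoly R[n]} := \sum_(i < d) c i.+2 *: iter i.+1 D f.

(** Every term of the tail already carries at least one [D]. *)
Lemma iter_exp_tail d f : iter d.+1 D f = 0 -> iter d D (exp_tail d f) = 0.
Proof.
move=> Df0; rewrite iter_linear_sum big1 // => i _.
by rewrite iter_linearZ -iterD (iter_eq0_leq _ Df0) ?scaler0 // addnS ltnS leq_addr.
Qed.

Lemma pactN_pexp d f : iter d.+1 D f = 0 ->
  pactN (pexp lnD) f = D (f + exp_tail d f).
Proof.
(* Cutting at [d.+2] leaves exactly [d] terms beyond [f + D f], matching the tail. *)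
move=> Df0; have D2f0 : iter d.+2 D f = 0 by rewrite iterS Df0 linear0.
rewrite /pactN /= pact_pexp (lnexpE lnD D2f0) /exp_trunc !big_ord_recl /=.
rewrite fact0 invr1 !scale1r addrAC subrr add0r linearD linear_sum /=.
by congr (_ + _); apply: eq_bigr => i _; rewrite linearZ.
Qed.

(** If [N g = 0], then [N (D g) = D (N g) = 0], and induction applied to [D g] gives [D (D g) = 0];
    then [N g] reduces to [D g]. *)
Lemma kernel_pactN_pexp g : kernel D g <-> kernel (pactN (pexp lnD)) g.
Proof.
split=> [Dg0|].
  by rewrite /kernel (@pactN_pexp 0) // /exp_tail big_ord0 addr0.
have [d /eqP/(iter_eq0_leq (leqnSn d))] := lnD g.
elim: d g => // d IHd g Dg0 Ng0.
have D2g0 : D (D g) = 0.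
  apply: IHd; first by rewrite -iterSr.
  (* The cut for [D g] is one longer than needed, so that it matches the expansion of [N g] term by
     term. *)
  rewrite /kernel (@pactN_pexp d.+1); last by rewrite -iterSr iterS Dg0 linear0.
  rewrite -[RHS](linear0 D) -[in RHS]Ng0 (pactN_pexp Dg0); congr (D _).
  rewrite linearD; congr (_ + _); rewrite linear_sum; apply: eq_bigr => i _.
  by rewrite linearZ -iterSr.
have := Ng0; rewrite /kernel (@pactN_pexp 1) // linearD /exp_tail big_ord1 linearZ /=.
by rewrite D2g0 scaler0 addr0.
Qed.

(** One inclusion is [N = D \o U]. For the other, [D g] is [N g] minus [D] of the tail; the tail has
    lower order, so induction writes the latter as [N k], whence the witness [g - k]. *)
Lemma image_pactN_pexp h : image_of (pactN (pexp lnD)) h <-> image_of D h.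
Proof.
split=> [[g <-]|[g <-]]; have [d /eqP/(iter_eq0_leq (leqnSn d)) Dg0] := lnD g.
  by exists (g + exp_tail d g); rewrite (pactN_pexp Dg0).
elim: d g Dg0 => [|d IHd] g Dg0; first by exists 0; rewrite linear0.
have [k Nk] := IHd _ (iter_exp_tail Dg0).
by exists (g - k); rewrite linearB Nk (pactN_pexp Dg0) linearD addrK.
Qed.

End LocallyNilpotentDerivation.

Theorem theorem2p7 (R : comAlgType rat) (n : nat)
    (F : n.-tuple {mpoly R[n]})
    (D : {linear {mpoly R[n]} -> {mpoly R[n]}})
    (derD : derivation D) (lnD : locally_nilpotent D)
    (autF : poly_automorphism F) (uniF : unipotent F)
    (defF : F = pexp lnD) :
  [/\ forall g : {mpoly R[n]}, inv F g <-> kernel D g,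
      forall g : {mpoly R[n]}, kernel D g <-> kernel (pactN F) g
    & forall h : {mpoly R[n]}, image_of (pactN F) h <-> image_of D h].
Proof.
have kerE g : kernel D g <-> kernel (pactN F) g.
  by rewrite defF; apply: kernel_pactN_pexp.
split=> // [g|h]; last by rewrite defF; apply: image_pactN_pexp.
split=> [Fg|/kerE/eqP]; last by rewrite /= subr_eq0 => /eqP.
by apply/kerE; rewrite /kernel /= Fg subrr.
Qed.
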